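(* Let $d,m,k\ge 1$ be integers, let $L$ be a lattice in $\mathbb{R}^d$ and let $L_1,\dots,L_m$ be $m$ sublattices of $L$. Let $S=L\setminus(L_1\cup\dots\cup L_m)$ and $r=\operatorname{rank}(L)$. Then the quantitative $S$-Helly number $\mathbb{H}_S(k)$ exists (is finite) and \[ \mathbb{H}_S(k)\le\left(2^{m+1}k+1\right)^r . \] Moreover, \[ \mathbb{T}_S(m,k)\le\left(2^{m+1}k+1\right)^r(m-1)\,k\,d+k . \]
   Context: A lattice in $\mathbb{R}^d$ is a discrete subgroup of $\mathbb{R}^d$ (not necessarily of full rank), and a sublattice is a subgroup of a lattice. Quantitative $S$-Tverberg number: for positive integers $m,k$, $\mathbb{T}_S(m,k)$ is the smallest positive integer $N$ (if it exists) such that for any $N$ distinct points of $S$ there is a partition of them into $m$ sets $A_1,\dots,A_m$ such that $\bigcap_{i=1}^m\operatorname{conv}(A_i)$ contains at least $k$ points of $S$. If no such integer exists, $\mathbb{T}_S(m,k)=\infty$. Quantitative $S$-Helly number: for a positive integer $k$, $\mathbb{H}_S(k)$ is the smallest positive integer $h$ (if it exists) with the following property: whenever $\mathcal F$ is a nonempty finite family of convex sets in $\mathbb{R}^d$ such that $\bigcap\mathcal G$ contains at least $k$ points of $S$ for every nonempty subfamily $\mathcal G\subseteq\mathcal F$ having at most $h$ members, then $\bigcap\mathcal F$ contains at least $k$ points of $S$. If no such integer exists, $\mathbb{H}_S(k)=\infty$. *)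

(* Defs.v *)
From mathcomp Require Import all_boot all_order all_algebra.
From mathcomp Require Import all_classical all_reals all_analysis.

Set Implicit Arguments.
Unset Strict Implicit.
Unset Printing Implicit Defensive.

Import Order.TTheory GRing.Theory Num.Theory.
Import numFieldNormedType.Exports.

Local Open Scope classical_set_scope.
Local Open Scope ring_scope.

Definition is_subgroup (V : zmodType) (G : set V) : Prop :=
  zmod_closed (mem G).

(* Discreteness means that every point is isolated for the topology of R^d;
   the rank of L may be smaller than d. *)
Definition is_lattice (R : realType) (d : nat) (L : set 'rV[R]_d) : Prop :=
  is_subgroup L /\ L `<=` isolated L.

Definition is_sublattice (R : realType) (d : nat) (M L : set 'rV[R]_d) : Prop :=
  is_subgroup M /\ M `<=` L.

(* The dimension of the real linear span of L, as the largest number of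
   linearly independent vectors in L (at most d of them can be independent).
   For a discrete subgroup it equals the rank as an abelian group. *)
Definition lattice_rank (R : realType) (d : nat) (L : set 'rV[R]_d) : nat :=
  (\max_(n < d.+1 |
      `[< exists X : n.-tuple 'rV[R]_d, [set` X] `<=` L /\ free X >]) n)%N.

Definition convex_hull (R : realType) (V : lmodType R) (A : set V) : set V :=
  smallest (@convex_set R V) A.

Definition at_least (T : Type) (k : nat) (A : set T) : Prop :=
  (`I_k #<= A)%card.

(* None stands for the value infinity. *)
Definition least_positive (P : nat -> Prop) : option nat :=
  if pselect (exists n, `[< (0 < n)%N /\ P n >]) is left exP
  then Some (ex_minn exP) else None.

(* The N points are distinct because X is a set of cardinality N. *)
Definition tverberg_prop (R : realType) (V : lmodType R) (S : set V)
    (m k N : nat) : Prop :=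
  forall X : set V, X `<=` S -> (X #= `I_N)%card ->
  exists2 A : 'I_m -> set V, partition [set: 'I_m] A X &
    at_least k ((\bigcap_i convex_hull (A i)) `&` S).

Definition tverberg_number (R : realType) (V : lmodType R) (S : set V)
    (m k : nat) : option nat :=
  least_positive (tverberg_prop S m k).

Definition helly_prop (R : realType) (V : lmodType R) (S : set V)
    (k h : nat) : Prop :=
  forall F : set (set V), finite_set F -> F !=set0 ->
  (forall C, F C -> @convex_set R V C) ->
  (forall G : set (set V), G `<=` F -> G !=set0 -> (G #<= `I_h)%card ->
     at_least k ((\bigcap_(C in G) C) `&` S)) ->
  at_least k ((\bigcap_(C in F) C) `&` S).

Definition helly_number (R : realType) (V : lmodType R) (S : set V)
    (k : nat) : option nat :=
  least_positive (helly_prop S k).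

(* Main.v *)
Require Import Defs.
From mathcomp Require Import all_boot all_order all_algebra all_field finmap.
From mathcomp Require Import all_classical all_reals all_analysis.
From mathcomp Require Import ring lra zify.

(** The Helly bound comes from one property of S. Put n = 2^(m+1) k + 1. Since
    L / n L has at most n^r elements, any more than n^r points of S contain two
    points a and b = a + n v with v in L ([lattice_pigeonhole]). The points
    a + t v with 0 < t < n lie in L, and any 2^m consecutive ones include a point
    outside all the L_i: m cosets of subgroups of Z that cover 2^m consecutive
    integers cover everything after them ([subgroups_cover_progression]), whereas
    b is not covered. So the open segment from a to b contains k points of S
    ([progression_points]).

    That property bounds the Helly number ([helly_of_collisions]). Only finitely
    many points of S matter, those of a large box. Among them, each convex set of
    the family is an intersection of initial segments of linear orders compatible
    with the vector structure. Suppose that all these segments have fewer than k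
    points in common, and enlarge them to a maximal system of segments with that defect
    ([critical_segments]). Each segment that is still proper has a least missing
    point, and this point lies in every other segment. If at most n^r segments are
    proper, the hypothesis on small subfamilies is violated. If more are, two of
    the missing points a and b are as above; in each of the orders, a point
    strictly between a and b precedes one of them, hence lies in the segment, so
    the k points of S between a and b are common to all segments.

    For the Tverberg bound let h = n^r and D = (m-1) k d, and let X consist of
    h D + k points of S. Any h subsets of X that miss at most D points each have k
    points in common, so by Helly the hulls of all such subsets share k points of
    S. Equivalently, for every such order more than D points of X are at or above
    the largest of these k points. The parts are then removed from X one
    by one. A part is a union of k subsets of X, each minimal with one of the k
    points in its hull, and a minimal set of this kind has at most d points at or
    above the point ([minimal_hull_above]; this saves one point over Caratheodory's
    theorem). Each removal therefore costs at most k d of the points above, and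
    after m - 1 removals the rest still has all k points in its hull
    ([greedy_coloring]). *)

Set Implicit Arguments.
Unset Strict Implicit.
Unset Printing Implicit Defensive.

Import Order.TTheory GRing.Theory Num.Theory.
Import numFieldNormedType.Exports.

Local Open Scope classical_set_scope.
Local Open Scope ring_scope.

(** * Convex sets and total cones *)

Lemma convex_setP (R : realType) (V : lmodType R) (A : set V) :
  @convex_set R V A <->
  forall (t : R) (x y : V), 0 <= t -> t <= 1 -> A x -> A y ->
    A (t *: x + (1 - t) *: y).
Proof.
split=> [cA t x y t0 t1 Ax Ay|cA x y t].
  by have := cA x y (Itv01 t0 t1); rewrite !inE; apply.
rewrite !inE => Ax Ay; exact: (cA t%:num x y).
Qed.

Lemma convex_hull_convex (R : realType) (V : lmodType R) (A : set V) :
  @convex_set R V (convex_hull A).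
Proof.
apply/convex_setP => t x y t0 t1 Ax Ay B [cB AB].
by move/convex_setP: (cB); apply => //; [apply: Ax|apply: Ay].
Qed.

Section TotalCones.
Variables (R : realType) (V : lmodType R).

(** The strictly positive elements of a partial order on V that is compatible
    with addition and positive scaling; a total cone is the case of a linear
    order. *)
Record blunt_cone (Q : set V) : Prop := BluntCone {
  cone_not0 : ~ Q 0;
  coneD : forall x y, Q x -> Q y -> Q (x + y);
  coneZ : forall (t : R) x, 0 < t -> Q x -> Q (t *: x) }.

Record total_cone (Q : set V) : Prop := TotalCone {
  total_cone_blunt :> blunt_cone Q;
  cone_total : forall x, x <> 0 -> Q x \/ Q (- x) }.

(** A cone that is maximal among the blunt cones containing P is total: if
    neither x nor -x were in Q, then Q together with the ray of x would generate
    a larger blunt cone. *)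
Lemma total_cone_extension (P : set V) : blunt_cone P ->
  exists2 Q, total_cone Q & P `<=` Q.
Proof.
move=> bP.
pose T := {Q : set V | blunt_cone Q /\ P `<=` Q}.
pose le (A B : T) := `[< sval A `<=` sval B >].
have [||||[Q [bQ PQ]] Qmax] := @Zorn T le.
- by move=> t; apply/asboolP.
- move=> r s t /asboolP rs /asboolP st; apply/asboolP; exact: subset_trans st.
- move=> [s sP] [t tP] /asboolP /= st /asboolP /= ts.
  exact/eq_exist/seteqP.
- move=> A Atot; have [[a Aa]|A0] := pselect (exists a, A a); last first.
    exists (exist _ P (conj bP (@subset_refl _ P))) => s As.
    by exfalso; apply: A0; exists s.
  pose U := \bigcup_(s in A) sval s.
  have bU : blunt_cone U.
    split=> [[s As s0]|x y [s As sx] [t At ty]|t x t0 [s As sx]].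
    + by case: (svalP s) => -[+ _ _] _; apply.
    + case: (Atot s t As At) => /asboolP st.
        exists t => //; case: (svalP t) => -[_ + _] _; apply => //; exact: st.
      exists s => //; case: (svalP s) => -[_ + _] _; apply => //; exact: st.
    + by exists s => //; case: (svalP s) => -[_ _ +] _; apply.
  have PU : P `<=` U by move=> x Px; exists a => //; apply: (svalP a).2.
  exists (exist _ U (conj bU PU)) => s As; apply/asboolP => x sx /=.
  by exists s.
exists Q => //; split=> // x x0; apply: contrapT => /not_orP[nQx nQNx].
(* The cone generated by Q and x. *)
pose Q' := [set z | exists2 t : R, 0 <= t & (Q (z - t *: x) \/ (z = t *: x /\ 0 < t))].
have QQ' : Q `<=` Q' by move=> z Qz; exists 0 => //; left; rewrite scale0r subr0.
have bQ' : blunt_cone Q'.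
  split.
  - case=> t t0; rewrite sub0r => -[Qt|[/esym/eqP]]; last first.
      by rewrite scaler_eq0 => /orP[/eqP ->|/eqP//]; rewrite ltxx.
    move: t0; rewrite le_eqVlt => /orP[/eqP t0|t0].
      by apply: (cone_not0 bQ); move: Qt; rewrite -t0 scale0r oppr0.
    apply: nQNx; have /(coneZ bQ) := Qt; move=> /(_ t^-1).
    by rewrite invr_gt0 scalerN scalerA mulVf ?gt_eqF// scale1r; apply.
  - move=> y z [s s0 hs] [t t0 ht]; exists (s + t); first exact: addr_ge0.
    have E : y + z - (s + t) *: x = (y - s *: x) + (z - t *: x).
      by rewrite scalerDl opprD addrACA.
    case: hs ht => [Qy|[-> s1]] [Qz|[-> t1]].
    + by left; rewrite E; apply: coneD.
    + by left; rewrite scalerDl opprD addrACA subrr addr0.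
    + by left; rewrite scalerDl opprD addrACA subrr add0r.
    + by right; rewrite scalerDl; split => //; exact: addr_gt0.
  - move=> s z s0 [t t0 h]; exists (s * t); first exact: mulr_ge0 (ltW _) _.
    case: h => [Qz|[-> t1]]; first by left; rewrite -scalerA -scalerBr; exact: coneZ.
    by right; rewrite scalerA; split => //; exact: mulr_gt0.
have PQ' : P `<=` Q' by apply: subset_trans QQ'.
have /(_ (asboolT QQ'))/(congr1 sval)/= E := Qmax (exist _ Q' (conj bQ' PQ')).
by apply: nQx; rewrite -E; exists 1 => //; right; rewrite scale1r.
Qed.

(** A point outside a convex set is separated from it by a linear order of the
    space. Unlike a linear functional, the order separates strictly and without
    any closedness of C, and has no ties: the vectors p - c span a blunt convex
    cone, which extends to a total one. *)
Lemma convex_total_cone (C : set V) (p : V) :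
  @convex_set R V C -> ~ C p ->
  exists2 Q, total_cone Q & forall c, C c -> Q (p - c).
Proof.
move=> /convex_setP cC nCp.
pose P := [set z | exists2 t : R, 0 < t & exists2 c, C c & z = t *: (p - c)].
have [|Q tQ PQ] := @total_cone_extension P; last first.
  by exists Q => // c Cc; apply: PQ; exists 1 => //; exists c; rewrite ?scale1r.
split.
- case=> t t0 [c Cc] /esym/eqP; rewrite scaler_eq0 gt_eqF//= subr_eq0 => /eqP pc.
  by apply: nCp; rewrite pc.
- move=> x y [s s0 [c Cc ->]] [t t0 [e Ce ->]].
  have st0 : 0 < s + t by exact: addr_gt0.
  exists (s + t) => //; exists (s / (s + t) *: c + (1 - s / (s + t)) *: e).
    apply: cC => //; first by rewrite divr_ge0 ?ltW.
    by rewrite ler_pdivrMr// mul1r lerDl ltW.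
  have E : (s + t) *: (s / (s + t) *: c + (1 - s / (s + t)) *: e) = s *: c + t *: e.
    rewrite scalerDr !scalerA; congr (_ *: _ + _ *: _); field; exact: lt0r_neq0.
  by rewrite [RHS]scalerBr E scalerDl !scalerBr opprD addrACA.
- move=> s z s0 [t t0 [c Cc ->]]; exists (s * t); first exact: mulr_gt0.
  by exists c => //; rewrite scalerA.
Qed.

End TotalCones.

(** * Systems of initial segments *)

(** An extremal argument: take U of maximal total size. For a missing point a of
    U i that is minimal in the order lt i, adding a to U i gives again a system
    of initial segments, so the common part must grow to at least k points; the
    only point it can gain is a, which is therefore in all the other segments. *)
Lemma critical_segments (I Y : finType) (lt : I -> rel Y) (H : I -> {set Y})
    (k : nat) :
  (forall i, irreflexive (lt i)) -> (forall i, transitive (lt i)) ->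
  (forall i x y, lt i x y -> y \in H i -> x \in H i) ->
  (#|\bigcap_i H i|%SET < k)%N ->
  exists U : I -> {set Y},
  [/\ forall i, H i \subset U i,
      forall i x y, lt i x y -> y \in U i -> x \in U i,
      (#|\bigcap_i U i|%SET < k)%N &
      forall i, U i != [set: Y]%SET ->
        exists a, [/\ a \notin U i, forall x, lt i x a -> x \in U i &
                      forall j, j != i -> a \in U j]].
Proof.
move=> ltI ltT Hseg Hk.
pose good := [pred U : {ffun I -> {set Y}} |
  [&& [forall i, H i \subset U i],
      [forall i, forall x, forall y, lt i x y ==> (y \in U i) ==> (x \in U i)] &
      (#|\bigcap_i U i|%SET < k)%N]].
have goodH : good [ffun i => H i].
  apply/and3P; split.
  - by apply/forallP => i; rewrite ffunE.
  - apply/forallP => i; apply/forallP => x; apply/forallP => y; rewrite ffunE.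
    by apply/implyP => xy; apply/implyP; exact: Hseg xy.
  - by rewrite (eq_bigr H) // => i _; rewrite ffunE.
case: (@arg_maxnP _ _ good (fun U => \sum_i #|U i|)%N goodH) => U gU Umax.
case/and3P: (gU) => /forallP HU /forallP Useg0 Uk.
have Useg i x y : lt i x y -> y \in U i -> x \in U i.
  by move=> xy; have /forallP/(_ x)/forallP/(_ y) := Useg0 i; rewrite xy /= => /implyP.
exists U; split => // i UiT.
have [b bU] : exists b, b \notin U i.
  apply/existsP; rewrite -negb_forall; apply: contra UiT => /forallP UT.
  by apply/eqP/setP => x; rewrite UT inE.
case: (@arg_minnP _ b (fun a => a \notin U i)
         (fun a => #|[set x | (x \notin U i) && lt i x a]%SET|) bU) => a aU amin.
have aseg x : lt i x a -> x \in U i.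
  move=> xa; apply: contraT => xU; have := amin x xU; rewrite leqNgt => /negP[].
  apply/proper_card/properP; split.
    apply/fintype.subsetP => y; rewrite !inE => /andP[yU yx].
    by rewrite yU; exact: ltT yx xa.
  by exists x; rewrite !inE xU ?xa// ltI.
exists a; split => // j ji.
pose U' := [ffun l => if l == i then a |: U i else U l]%SET.
have nU' : ~~ good U'.
  apply/negP => /Umax; rewrite /geq /= leqNgt => /negP[].
  rewrite (bigD1 i)//= [ltnRHS](bigD1 i)//= ffunE eqxx cardsU1 aU add1n addSn ltnS.
  by rewrite leq_add2l leq_sum// => l li; rewrite ffunE (negbTE li).
have : [exists z, (z \in \bigcap_l U' l)%SET && (z \notin \bigcap_l U l)%SET].
  apply: contraR nU'; rewrite negb_exists => /forallP sub.
  apply/and3P; split.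
  - apply/forallP => l; rewrite ffunE; case: eqP => [->|_] //.
    by apply: fintype.subset_trans (HU i) _; exact: finset.subsetUr.
  - apply/forallP => l; apply/forallP => x; apply/forallP => y; rewrite ffunE.
    apply/implyP => xy; apply/implyP; case: eqP => [li|_]; last exact: Useg xy.
    rewrite !inE => /orP[/eqP ya|yU]; rewrite li ?ya in xy; first by rewrite aseg ?orbT.
    by rewrite (Useg _ _ _ xy yU) orbT.
  - apply: leq_ltn_trans Uk; apply/subset_leq_card/fintype.subsetP => z zU'.
    by move: (sub z); rewrite zU' /= negbK.
case/existsP => z /andP[/bigcapP zU' zU].
have zj l : l != i -> z \in U l.
  by move=> li; have := zU' l isT; rewrite ffunE (negbTE li).
have := zU' i isT; rewrite ffunE eqxx !inE => /orP[/eqP <-|zi]; first exact: zj.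
case/negP: zU; apply/bigcapP => l _.
by have [->//|] := eqVneq l i; exact: zj.
Qed.

(** * Lattices *)

Lemma at_leastP (T : choiceType) (k : nat) (A : set T) :
  at_least k A <->
  exists s : seq T, [/\ uniq s, size s = k & forall x, x \in s -> A x].
Proof.
split=> [/pcard_surjP[g gsurj]|[s [us ks sA]]].
  have /boolp.choice[f fP] : forall i : 'I_k, exists x, A x /\ g x = i.
    by move=> i; have [x Ax gx] := gsurj i (ltn_ord i); exists x.
  exists (codom f); split; last by move=> x /codomP[i ->]; case: (fP i).
    rewrite map_inj_uniq ?enum_uniq// => i j fij; apply/val_inj.
    by rewrite /= -(fP i).2 -(fP j).2 fij.
  by rewrite size_codom card_ord.
apply/pcard_surjP; exists (index ^~ s) => i /= ik.
case: s => [|x0 s] in us ks sA *; first by rewrite -ks in ik.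
exists (nth x0 (x0 :: s) i); first by apply/sA/mem_nth; rewrite ks.
by rewrite index_uniq// ks.
Qed.

Lemma finite_set_finType (T : choiceType) (A : set T) (F : finType) (f : T -> F) :
  (forall x y, A x -> A y -> f x = f y -> x = y) -> finite_set A.
Proof.
move=> finj; have [[x0 _]|A0] := pselect (exists x, A x); last first.
  suff -> : A = set0 by exact: finite_set0.
  by apply/seteqP; split=> // x Ax; apply: A0; exists x.
pose g c := xget x0 [set x | A x /\ f x = c].
apply: (@sub_finite_set _ _ (g @` [set: F])); last exact/finite_image/finite_finset.
move=> x Ax; exists (f x) => //; rewrite /g; case: xgetP => [y _ [Ay fy]|/(_ x)].
  exact: finj.
by case.
Qed.

Section Subgroups.
Variables (V : zmodType) (G : set V).
Hypothesis sG : is_subgroup G.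

Lemma subgroup0 : G 0.
Proof. by case: sG; rewrite inE. Qed.

Lemma subgroupB x y : G x -> G y -> G (x - y).
Proof. by case: sG => _ GB Gx Gy; have := GB x y; rewrite !inE; apply. Qed.

Lemma subgroupN x : G x -> G (- x).
Proof. by move=> Gx; rewrite -sub0r; apply: subgroupB => //; exact: subgroup0. Qed.

Lemma subgroupD x y : G x -> G y -> G (x + y).
Proof. by move=> Gx Gy; rewrite -(opprK y); apply/subgroupB/subgroupN. Qed.

Lemma subgroupMn x n : G x -> G (x *+ n).
Proof.
move=> Gx; elim: n => [|n IH]; first by rewrite mulr0n; exact: subgroup0.
by rewrite mulrS; exact: subgroupD.
Qed.

Lemma subgroupMz x (z : int) : G x -> G (x *~ z).
Proof.
move=> Gx; case: z => n; first exact: subgroupMn.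
by rewrite NegzE mulrNz; apply/subgroupN/subgroupMn.
Qed.

Lemma subgroup_sum (I : Type) (s : seq I) (F : I -> V) :
  (forall i, G (F i)) -> G (\sum_(i <- s) F i).
Proof. by move=> GF; apply: big_ind => //; [exact: subgroup0|exact: subgroupD]. Qed.

End Subgroups.

Section Lattices.
Variables (R : realType) (d : nat) (L : set 'rV[R]_d).
Hypothesis latL : is_lattice L.
Let V := 'rV[R]_d.

Lemma lattice_gap : exists2 e : R, 0 < e &
  forall x, L x -> (forall j, `|x 0 j| < e) -> x = 0.
Proof.
have [_ [U U0 UL]] : isolated L (0 : V) by apply: latL.2; apply: subgroup0; exact: latL.1.
move/nbhs_ballP: U0 => [e /= e0 eU]; exists e => // x Lx xe.
suff : (U `&` L) x by rewrite UL.
split=> //; apply: eU; split=> // i j; rewrite ord1 /ball /= mxE sub0r normrN.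
exact: xe.
Qed.

(** Distinct points of L differ by at least the gap e in some coordinate, so a
    grid of mesh e has at most one of them in each cell. *)
Lemma lattice_bounded_finite (M : R) :
  finite_set (L `&` [set x | forall j, `|x 0 j| <= M]).
Proof.
have [e e0 gap] := lattice_gap.
pose K := Num.truncn ((M + M) / e).
pose cell (x : V) : {ffun 'I_d -> 'I_K.+1} :=
  [ffun j => inord (Num.truncn ((x 0 j + M) / e))].
apply: (finite_set_finType (f := cell)) => x y [Lx /= xM] [Ly /= yM] xy.
apply/eqP; rewrite -subr_eq0; apply/eqP; apply: gap.
  by apply: subgroupB => //; exact: latL.1.
move=> j; rewrite !mxE.
have rng z : `|z| <= M -> 0 <= (z + M) / e /\ (Num.truncn ((z + M) / e) < K.+1)%N.
  rewrite ler_norml => /andP[z1 z2]; have ze : 0 <= (z + M) / e.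
    by rewrite divr_ge0 ?(ltW e0)// -lerBlDr sub0r.
  by split=> //; rewrite ltnS /K le_truncn// ler_pM2r ?invr_gt0// lerD2r.
have [x0 xK] := rng _ (xM j); have [y0 yK] := rng _ (yM j).
move/ffunP: xy => /(_ j)/(congr1 val); rewrite !ffunE /= !inordK// => E.
have /andP[] := truncn_itv x0; have /andP[] := truncn_itv y0; rewrite E.
rewrite !mulrS; set t : R := (Num.truncn _)%:R => h1 h2 h3 h4.
have -> : x 0 j - y 0 j = ((x 0 j + M) / e - (y 0 j + M) / e) * e.
  by field; exact: lt0r_neq0.
rewrite normrM (gtr0_norm e0) gtr_pMl// ltr_norml; apply/andP; split; lra.
Qed.

Lemma lattice_rank_basis : exists X : (lattice_rank L).-tuple V,
  [/\ forall i, L X`_i, free X & forall x, L x -> x \in <<X>>%VS].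
Proof.
have memP n (X : n.-tuple V) : [set` X] `<=` L -> forall i, L X`_i.
  move=> XL i; have [iX|iX] := ltnP i (size X); first by apply: XL; exact: mem_nth.
  by rewrite nth_default//; apply: subgroup0; exact: latL.1.
pose P n := `[< exists X : n.-tuple V, [set` X] `<=` L /\ free X >].
have P0 : P 0%N by apply/asboolP; exists [tuple]; split=> //; rewrite nil_free.
have cP : (0 < #|[pred n : 'I_d.+1 | P n]|)%N.
  by apply/card_gt0P; exists ord0.
have [n Pn rn] := eq_bigmax_cond (fun n : 'I_d.+1 => n : nat) cP.
have {}rn : lattice_rank L = n by rewrite -rn.
rewrite rn; have /asboolP[X [XL fX]] := Pn; exists X; split=> // [|x Lx].
  exact: memP.
apply: contraT => xX.
have fxX : free (x :: X) by rewrite free_cons xX.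
have n1d : (n.+1 < d.+1)%N.
  have : (\dim <<x :: X>>%VS <= \dim (fullv : {vspace V}))%N by rewrite dimvS// subvf.
  by rewrite (eqP fxX) /= size_tuple dimvf /dim /= mul1n.
have : P n.+1.
  apply/asboolP; exists [tuple of x :: X]; split=> // y /=.
  by rewrite inE => /orP[/eqP ->//|]; exact: XL.
move=> Pn1; have := @leq_bigmax_cond _ (fun i : 'I_d.+1 => P i) (fun i => i : nat) (Ordinal n1d) Pn1.
by rewrite -/(lattice_rank L) rn ltnn.
Qed.

End Lattices.

Section LatticePigeonhole.
Variables (R : realType) (d : nat) (L : set 'rV[R]_d).
Hypothesis latL : is_lattice L.
Let V := 'rV[R]_d.

(** This says that L / n L has at most n^r elements, for r the rank of L. Let Z be
    the subgroup spanned by a basis X of the span of L in L, and D the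
    points of L in the half-open parallelepiped of X, a transversal of L / Z.
    If the a i are pairwise incongruent modulo n L, the points a i + n x with x in
    D are pairwise incongruent modulo n Z: in a congruence between two of them,
    the a i must agree, and then the x are congruent modulo Z, hence equal. As
    L / n Z has #|D| n^r elements, there are at most n^r indices i. This avoids
    integral bases of L. *)
Lemma lattice_pigeonhole (n : nat) (I : finType) (a : I -> V) :
  (0 < n)%N -> (forall i, L (a i)) -> (n ^ lattice_rank L < #|I|)%N ->
  exists i j, i != j /\ exists2 v, L v & a j = a i + v *+ n.
Proof.
move=> n0 La; set r := lattice_rank L; rewrite ltnNge; apply: contraNP => none.
have sL := latL.1.
have [X [LX fX spX]] := lattice_rank_basis latL.
pose c i x := coord X i x.
have cB i x y : c i (x - y) = c i x - c i y by rewrite /c linearB.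
have cE x : L x -> x = \sum_i c i x *: X`_i by move=> Lx; exact/coord_span/spX.
pose comb (z : 'I_r -> int) : V := \sum_(i < r) X`_i *~ z i.
have Lcomb z : L (comb z).
  by apply: subgroup_sum => // i; apply: subgroupMz => //; exact: LX.
have c_comb z i : c i (comb z) = (z i)%:~R.
  rewrite /c /comb linear_sum (bigD1 i)//= big1 ?addr0 => [|j ji].
    by rewrite raddfMz /= coord_free// eqxx.
  by rewrite raddfMz /= coord_free// (negbTE ji) mul0rz.
pose D : set V := L `&` [set x | forall i, 0 <= c i x /\ c i x < 1].
pose fl x := comb (fun i => Num.floor (c i x)).
have Dfrac x : L x -> D (x - fl x).
  move=> Lx; split=> [|i]; first exact: (subgroupB sL Lx (Lcomb _)).
  rewrite cB c_comb; have /andP[] := floor_itv (c i x).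
  rewrite intrD; set t : R := (_)%:~R => h1 h2; split; lra.
have finD : finite_set D.
  pose M : R := \sum_(i < r) \sum_j `|X`_i 0 j|.
  apply: sub_finite_set (lattice_bounded_finite latL M) => x [Lx Dx].
  split=> //= j; rewrite [x]cE// summxE; apply: le_trans (ler_norm_sum _ _ _) _.
  apply: ler_sum => i _; rewrite mxE normrM; have [ci0 ci1] := Dx i.
  apply: le_trans (_ : `|X`_i 0 j| <= _).
    by rewrite ler_piMl// ger0_norm// ltW.
  by rewrite (bigD1 j)//= lerDl sumr_ge0.
have D0 : D 0.
  split=> [|i]; first exact: subgroup0.
  by rewrite /c linear0.
pose DT := fset_set D.
have inD x : (x \in DT) = (x \in D) by rewrite in_fset_set.
have D0T : 0 \in DT by rewrite inD inE.
have valD (x : DT) : D (val x) by have := valP x; rewrite inD inE.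
case: n => // n in n0 none *.
(* The class of a i + n x modulo n Z: its representative in D, and the integral
   parts of its coordinates modulo n. *)
pose code (p : I * DT) : DT * {ffun 'I_r -> 'I_n.+1} :=
  let l := a p.1 + val p.2 *+ n.+1 in
  (insubd [` D0T]%fset (l - fl l), [ffun i => inord `|(Num.floor (c i l) %% n.+1)%Z|%N]).
suff /leq_card : injective code.
  rewrite !card_prod card_ffun !card_ord mulnC leq_pmul2l//.
  by apply/card_gt0P; exists [` D0T]%fset.
move=> [i x] [j y]; rewrite /code /=.
set l := a i + _; set l' := a j + _ => -[E1 E2].
have Ll : L l by apply: subgroupD => //; apply: subgroupMn => //; exact: (valD x).1.
have Ll' : L l' by apply: subgroupD => //; apply: subgroupMn => //; exact: (valD y).1.
have {}E1 : l - fl l = l' - fl l'.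
  have := congr1 val E1; rewrite !insubdK // inD inE; exact: Dfrac.
have /boolp.choice[q qE] : forall i, exists q : int,
    Num.floor (c i l') - Num.floor (c i l) = q * n.+1%:Z.
  move=> i0; apply/dvdzP; rewrite -eqz_mod_dvd.
  move/ffunP: E2 => /(_ i0)/(congr1 val); rewrite !ffunE /=.
  have B z : (`|(z %% n.+1)%Z|%N < n.+1)%N.
    by rewrite -ltz_nat gez0_abs ?modz_ge0// ltz_pmod.
  rewrite !inordK ?B// => E; apply/eqP.
  by rewrite -[LHS]gez0_abs ?modz_ge0// -E gez0_abs ?modz_ge0.
have flE : fl l' - fl l = comb q *+ n.+1.
  rewrite /fl /comb -sumrB -sumrMnl; apply: eq_bigr => i0 _.
  by rewrite -mulrzBr qE mulrzA pmulrn.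
have E : a j - a i = (comb q + val x - val y) *+ n.+1.
  have E0 : l' - l = (a j - a i) + (val y - val x) *+ n.+1.
    by rewrite /l /l' opprD addrACA mulrnBl.
  have E3 : l' - l = fl l' - fl l.
    apply/eqP; rewrite -subr_eq0 opprB [fl l - _]addrC addrACA -E1 addrACA subrr.
    by rewrite addNr addr0.
  by rewrite -addrA -[val x - _]opprB mulrnBl -flE -E3 E0 addrK.
have ij : i = j.
  apply/eqP/negPn/negP => ij; apply: none; exists i, j; split=> //.
  exists (comb q + val x - val y); last by rewrite -E addrC subrK.
  by apply: subgroupB => //; [apply: subgroupD => //; exact: (valD x).1|exact: (valD y).1].
rewrite ij; congr pair; move/eqP: E; rewrite ij subrr eq_sym.
rewrite -scaler_nat scaler_eq0 pnatr_eq0 /= => /eqP xy.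
have cxy i0 : c i0 (val y) - c i0 (val x) = (q i0)%:~R.
  rewrite -c_comb -cB; congr (c i0 _).
  by apply/esym/eqP; rewrite -subr_eq0 opprB addrA xy.
apply/val_inj/eqP; rewrite eq_sym -subr_eq0; apply/eqP.
have Lx := (valD x).1; have Ly := (valD y).1.
rewrite [LHS]cE; last exact: subgroupB.
apply: big1 => i0 _; rewrite cB cxy.
have [x0 x1] := (valD x).2 i0; have [y0 y1] := (valD y).2 i0.
suff -> : q i0 = 0 by rewrite scale0r.
have : -1 < q i0 by rewrite -(ltr_int R) mulrNz -cxy; lra.
have : q i0 < 1 by rewrite -(ltr_int R) -cxy; lra.
lia.
Qed.

End LatticePigeonhole.

(** * Progressions covered by subgroups *)

(** The sequence f satisfies the linear recurrence whose characteristic polynomial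
    has the roots w j, of order #|J|, so #|J| consecutive zeros propagate. *)
Lemma exp_sum_vanish (F : fieldType) (J : finType) (c w : J -> F) (f : nat -> F)
    (x : nat) :
  (forall y, f y = \sum_j c j * w j ^+ y) ->
  (forall t, (t < #|J|)%N -> f (x + t)%N = 0) ->
  forall y, (x <= y)%N -> f y = 0.
Proof.
move=> fE f0.
pose p := \prod_(j <- enum J) ('X - (w j)%:P).
have sp : size p = #|J|.+1 by rewrite size_prod_XsubC -cardE.
have pm : p`_#|J| = 1.
  by have := monic_prod_XsubC (enum J) predT w => /monicP; rewrite /lead_coef sp.
have rec y : \sum_(t < #|J|.+1) p`_t * f (y + t)%N = 0.
  under eq_bigr do rewrite fE mulr_sumr.
  rewrite exchange_big /= big1 // => j _.
  rewrite (eq_bigr (fun t : 'I_#|J|.+1 => c j * w j ^+ y * (p`_t * w j ^+ t))).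
    rewrite -mulr_sumr -sp -horner_coef; apply/eqP; rewrite mulf_eq0; apply/orP; right.
    by rewrite /p horner_prod big_enum /= (bigD1 j)//= hornerXsubC subrr mul0r.
  by move=> t _; rewrite exprD; ring.
suff G t : f (x + t)%N = 0 by move=> y xy; rewrite -(subnKC xy).
have [n] := ubnP t; elim: n t => // n IH t tn.
have [|Jt] := ltnP t #|J|; first exact: f0.
have := rec (x + (t - #|J|))%N; rewrite big_ord_recr /= pm mul1r -addnA subnK//.
rewrite big1 ?add0r// => i _; rewrite -addnA IH ?mulr0//.
by rewrite -ltnS; apply: leq_trans tn; rewrite ltnS -{2}(subnK Jt) ltn_add2l.
Qed.

(** The product expands into a sum of 2^#|I| exponentials, one for each subset of
    the factors. *)
Lemma exp_prod_vanish (F : fieldType) (I : finType) (l z : I -> F) (x : nat) :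
  (forall t, (t < 2 ^ #|I|)%N -> \prod_i (1 - l i * z i ^+ (x + t)) = 0) ->
  forall y, (x <= y)%N -> \prod_i (1 - l i * z i ^+ y) = 0.
Proof.
move=> H.
apply: (@exp_sum_vanish _ {set I} (fun A : {set I} => \prod_i (if i \in A then 1 else - l i))
          (fun A : {set I} => \prod_i (if i \in A then 1 else z i))
          (fun y => \prod_i (1 - l i * z i ^+ y))) => [y|t]; last first.
  by rewrite -cardsT -powersetT card_powerset cardsT; exact: H.
rewrite bigA_distr; apply: eq_bigr => A _; rewrite -prodrXl -big_split /=.
by apply: eq_bigr => i _; case: ifP => _; rewrite ?expr1n ?mul1r ?mulNr.
Qed.

(** The t with a + t v in G form a coset of a subgroup c Z, or the empty set. For
    c > 0, z is a primitive root of unity of order c; for c = 0, powers of z = 2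
    are pairwise distinct; l = 0 encodes the empty set. *)
Lemma coset_exponential (V : zmodType) (G : set V) (a v : V) : is_subgroup G ->
  exists l z : algC, forall t : nat, G (a + v *+ t) <-> l * z ^+ t = 1.
Proof.
move=> sG.
have GB x y : G x -> G y -> G (x - y) by exact: subgroupB.
have [[t0 Gt0]|none] := pselect (exists t, G (a + v *+ t)); last first.
  exists 0, 0 => t; rewrite mul0r; split=> [Gt|/eqP].
    by case: none; exists t.
  by rewrite eq_sym oner_eq0.
suff [z z0 Hz] : exists2 z : algC, z != 0 &
    forall i j : nat, (j <= i)%N -> G (v *+ (i - j)) <-> z ^+ i = z ^+ j.
  exists (z ^- t0), z => t.
  have -> : (z ^- t0 * z ^+ t = 1) <-> (z ^+ t = z ^+ t0).
    split=> [E|->]; last by rewrite mulVf ?expf_neq0.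
    by rewrite -[LHS]mul1r -(mulfV (expf_neq0 t0 z0)) -mulrA E mulr1.
  have [tt|/ltnW tt] := leqP t0 t.
    rewrite -Hz //; have -> : v *+ (t - t0) = (a + v *+ t) - (a + v *+ t0).
      by rewrite mulrnBr// opprD addrACA subrr add0r.
    split=> [Gt|Gt]; first exact: GB.
    by rewrite -(subrK (a + v *+ t0) (a + v *+ t)); exact: (subgroupD sG Gt Gt0).
  have -> : (z ^+ t = z ^+ t0) <-> (z ^+ t0 = z ^+ t) by split=> ->.
  rewrite -Hz //.
  have -> : v *+ (t0 - t) = (a + v *+ t0) - (a + v *+ t).
    by rewrite mulrnBr// opprD addrACA subrr add0r.
  split=> [Gt|Gt]; first exact: GB.
  by rewrite -(subKr (a + v *+ t0) (a + v *+ t)); exact: GB.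
have [exP|none] := pselect (exists t, `[< (0 < t)%N /\ G (v *+ t) >]); last first.
  exists 2 => [|i j ji]; first by rewrite pnatr_eq0.
  have [->|ij] := eqVneq i j; first by rewrite subnn mulr0n; split=> // _; exact: subgroup0.
  split=> [Gij|].
    case: none; exists (i - j)%N; apply/asboolP; split=> //.
    by rewrite subn_gt0 ltn_neqAle ji eq_sym ij.
  by rewrite -!natrX => /eqP; rewrite eqr_nat eqn_exp2l// (negbTE ij).
case: (ex_minnP exP) => c /asboolP[c0 Gc] cmin.
have [z pz] := C_prim_root_exists c0.
exists z => [|i j ji].
  apply/negP => /eqP z0; have := prim_expr_order pz.
  by rewrite z0 expr0n gtn_eqF// => /eqP; rewrite eq_sym oner_eq0.
have -> : (z ^+ i = z ^+ j) <-> (c %| i - j)%N.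
  by rewrite -eqn_mod_dvd// -(eq_prim_root_expr pz); split=> /eqP.
split=> [Gij|/dvdnP[q ->]]; last by rewrite mulnC mulrnA; exact: subgroupMn.
rewrite /dvdn; have [//|r0] := posnP ((i - j) %% c).
have := ltn_pmod (i - j) c0; rewrite ltnNge => /negP[]; apply: cmin.
apply/asboolP; split=> //.
have -> : v *+ ((i - j) %% c) = v *+ (i - j) - v *+ c *+ ((i - j) %/ c).
  by rewrite {2}(divn_eq (i - j) c) mulrnDr mulnC mulrnA addrAC subrr add0r.
by apply: GB => //; exact: subgroupMn.
Qed.

(** A covering theorem of Crittenden and Vanden Eynden. Encoding each coset as
    the zeros of 1 - l z^t turns the union of the cosets into the zeros of a
    product, to which the recurrence applies. *)
Lemma subgroups_cover_progression (V : zmodType) (m : nat) (G : 'I_m -> set V)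
    (a v : V) (x y : nat) :
  (forall i, is_subgroup (G i)) ->
  (forall t, (t < 2 ^ m)%N -> exists i, G i (a + v *+ (x + t))) ->
  (x <= y)%N -> exists i, G i (a + v *+ y).
Proof.
move=> sG cov xy.
have /boolp.choice[lz lzP] : forall i, exists lz : algC * algC,
    forall t : nat, G i (a + v *+ t) <-> lz.1 * lz.2 ^+ t = 1.
  by move=> i; have [l [z H]] := coset_exponential a v (sG i); exists (l, z).
have prod0 t : (exists i, G i (a + v *+ t)) <->
    \prod_i (1 - (lz i).1 * (lz i).2 ^+ t) = 0.
  split=> [[i /lzP E]|/eqP/prodf_eq0[i _ /eqP/subr0_eq/esym/lzP E]]; last by exists i.
  by apply/eqP/prodf_eq0; exists i => //; rewrite E subrr.
apply/prod0; apply: exp_prod_vanish xy => t; rewrite card_ord => tm.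
exact/prod0/cov.
Qed.

(** * The Helly number *)

(** Cut the open segment into blocks of 2^m consecutive terms of the progression.
    A block covered by the subgroups would force the end point a + n v to be
    covered, so each of the first k blocks contributes a point. *)
Lemma progression_points (R : realType) (V : lmodType R) (m k n : nat)
    (L : set V) (Ls : 'I_m -> set V) (a v : V) :
  is_subgroup L -> (forall i, is_subgroup (Ls i)) ->
  (2 ^ m * k < n)%N -> v != 0 -> L v ->
  (L `\` \bigcup_i Ls i) a -> (L `\` \bigcup_i Ls i) (a + v *+ n) ->
  exists s : seq V, [/\ uniq s, size s = k & forall x, x \in s ->
    (L `\` \bigcup_i Ls i) x /\
    exists2 t : R, 0 < t < 1 & x = a + t *: (a + v *+ n - a)].
Proof.
move=> sL sLs kn v0 Lv [La _] [_ nb].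
have /boolp.choice[f fP] : forall q : 'I_k, exists t : nat,
    (t < 2 ^ m)%N /\ ~ (\bigcup_i Ls i) (a + v *+ (1 + q * 2 ^ m + t)).
  move=> q; apply: contrapT => none; apply: nb.
  have [||i Li] := @subgroups_cover_progression V m Ls a v (1 + q * 2 ^ m) n sLs.
  - move=> t tm; apply: contrapT => nt; apply: none; exists t; split=> //.
    by case=> i _ Li; apply: nt; exists i.
  - have := ltn_ord q; have : (0 < 2 ^ m)%N by rewrite expn_gt0.
    by move: (2 ^ m)%N kn => e; nia.
  - by exists i.
pose g (q : 'I_k) := (1 + q * 2 ^ m + f q)%N.
have gn q : (0 < g q < n)%N.
  have [fq _] := fP q; have := ltn_ord q; rewrite /g.
  by move: (2 ^ m)%N (f q) kn fq => e t; nia.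
have ginj : injective g.
  move=> p q; have [fp _] := fP p; have [fq _] := fP q; rewrite /g => E.
  by apply/val_inj => /=; move: (2 ^ m)%N (f p) (f q) fp fq E => e t u; nia.
have n0 : n%:R != 0 :> R by rewrite pnatr_eq0 -lt0n; lia.
exists (codom (fun q => a + v *+ g q)); split; last first.
- move=> x /codomP[q ->]; split.
    split; last by case: (fP q).
    by apply: subgroupD => //; exact: subgroupMn.
  exists ((g q)%:R / n%:R).
    have /andP[g0 gqn] := gn q; have nR : 0 < n%:R :> R by rewrite ltr0n; lia.
    apply/andP; split; first by apply: divr_gt0; rewrite // ltr0n.
    by rewrite ltr_pdivrMr// mul1r ltr_nat.
  rewrite addrAC subrr add0r; congr (_ + _).
  by rewrite -[v *+ g q]scaler_nat -[v *+ n]scaler_nat scalerA divfK.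
- by rewrite size_codom card_ord.
rewrite map_inj_uniq ?enum_uniq// => p q /addrI/eqP.
rewrite -subr_eq0 -[v *+ g p]scaler_nat -[v *+ g q]scaler_nat -scalerBl.
rewrite scaler_eq0 (negbTE v0) orbF subr_eq0 eqr_nat.
by move=> /eqP/ginj.
Qed.

Lemma total_coneT (R : realType) (V : lmodType R) : exists Q : set V, total_cone Q.
Proof.
by have [|Q tQ _] := @total_cone_extension R V set0; [split|exists Q].
Qed.

Lemma uniq_fset_leq_card (T : choiceType) (Y : {fset T}) (A : {set Y}) (s : seq T) :
  uniq s -> (forall x, x \in s -> exists2 y : Y, y \in A & val y = x) ->
  (size s <= #|A|)%N.
Proof.
move=> us sA; have -> : #|A| = size [seq val y | y <- enum A] by rewrite size_map -cardE.
apply: uniq_leq_size us _ => x /sA[y yA <-].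
by apply: map_f; rewrite mem_enum.
Qed.

Lemma finset_card_le (I : finType) (A : {set I}) (n : nat) :
  (#|A| <= n)%N -> ([set` A] #<= `I_n)%card.
Proof.
move=> An; apply/pcard_leP/injfunPex; exists (index ^~ (enum A)).
  by move=> x /= xA; apply: leq_trans An; rewrite cardE index_mem mem_enum.
by move=> x y; rewrite !inE => xA yA /(congr1 (nth x (enum A))); rewrite !nth_index ?mem_enum.
Qed.

(** The linear orders are indexed by pairs (C, y) of a member of the family and a
    point y of the finite set of relevant points of S; when y is outside C, the
    order puts all of C before y, and the segment H of points before y excludes y.
    So the intersection of all the H is the part of the family's intersection
    among these points. *)
Lemma helly_of_collisions (R : realType) (d k h : nat) (S : set 'rV[R]_d) :
  (0 < h)%N ->
  (forall M : R, finite_set (S `&` [set x | forall j, `|x 0 j| <= M])) ->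
  (forall (I : finType) (a : I -> 'rV[R]_d), injective a ->
     (forall i, S (a i)) -> (h < #|I|)%N ->
     exists i j, i != j /\
       exists s : seq 'rV[R]_d, [/\ uniq s, size s = k & forall x, x \in s ->
         S x /\ exists2 t : R, 0 < t < 1 & x = a i + t *: (a j - a i)]) ->
  helly_prop S k h.
Proof.
move=> h0 finS collide F /finite_seqP[cs ->] [C0 /= C0cs] Fconv FH.
pose N := size cs; pose C (i : 'I_N) := nth set0 cs i.
have CF i : C i \in cs by exact: mem_nth.
have FC A : A \in cs -> exists i, A = C i.
  move=> Acs; have iN : (index A cs < N)%N by rewrite index_mem.
  by exists (Ordinal iN); rewrite /C nth_index.
have [i0 _] := FC _ C0cs.
apply: contrapT => notk.
(* For each small subfamily, k points of S common to its members; M bounds them. *)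
have /boolp.choice[w wP] : forall G : {set 'I_N}, exists s : seq 'rV[R]_d,
    (0 < #|G| <= h)%N -> [/\ uniq s, size s = k & forall x, x \in s ->
      S x /\ forall i, i \in G -> C i x].
  move=> G; have [/andP[G0 Gh]|Gh] := boolP (0 < #|G| <= h)%N; last by exists [::].
  have [|||s [us ks sG]] := (at_leastP k _).1 (FH (C @` [set` G]) _ _ _).
  - by move=> _ [i _ <-]; exact: CF.
  - by have /card_gt0P[i iG] := G0; exists (C i); exists i.
  - exact: card_le_trans (card_image_le _ _) (finset_card_le Gh).
  exists s => _; split=> // x /sG[xG Sx]; split=> // i iG.
  by apply: xG; exists i.
pose M : R := \sum_G \sum_(x <- w G) \sum_j `|x 0 j|.
have wM G x j : x \in w G -> `|x 0 j| <= M.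
  move=> xw; rewrite /M (bigD1 G)//= (big_rem x xw) /= (bigD1 j)//= -!addrA lerDl.
  by rewrite !addr_ge0// ?sumr_ge0// => *; rewrite ?sumr_ge0// => *; rewrite sumr_ge0.
pose Yset := S `&` [set x | forall j, `|x 0 j| <= M].
pose YT := fset_set Yset.
have inY x : Yset x -> x \in YT by move=> Yx; rewrite in_fset_set ?inE//; exact: finS.
have valY (y : YT) : Yset (val y) by have := valP y; rewrite in_fset_set ?inE//; exact: finS.
have /boolp.choice[Q QP] : forall p : 'I_N * YT, exists Q, total_cone Q /\
    (~ C p.1 (val p.2) -> forall c, C p.1 c -> Q (val p.2 - c)).
  move=> [i y] /=; have [Cy|nCy] := pselect (C i (val y)).
    by have [Q tQ] := @total_coneT R 'rV[R]_d; exists Q; split.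
  by have [Q tQ QC] := convex_total_cone (Fconv _ (CF i)) nCy; exists Q; split.
have tQ p : total_cone (Q p) by case: (QP p).
pose lt p : rel YT := fun x z => `[< Q p (val z - val x) >].
have ltT p : transitive (lt p).
  move=> y x z /asboolP xy /asboolP yz; apply/asboolP.
  by rewrite -(subrK (val y) (val z)) -addrA; apply: coneD => //; exact: tQ.
pose H (p : 'I_N * YT) : {set YT} :=
  if `[< C p.1 (val p.2) >] then [set: YT]%SET else [set x | lt p x p.2]%SET.
have Hseg p x y : lt p x y -> y \in H p -> x \in H p.
  move=> xy; rewrite /H; case: ifP => _; first by rewrite !inE.
  by rewrite 2!finset.inE => yz; exact: ltT xy yz.
have notk' (A : {set YT}) : (forall y, y \in A -> forall i, C i (val y)) -> (#|A| < k)%N.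
  move=> AC; rewrite ltnNge; apply/negP => kA; apply: notk; apply/at_leastP.
  exists (take k [seq val y | y <- enum A]); split.
  - by rewrite take_uniq// map_inj_uniq ?enum_uniq//; exact: val_inj.
  - by rewrite size_takel// size_map -cardE.
  - move=> x /mem_take/mapP[y]; rewrite mem_enum => yA ->.
    by split; [move=> A' /= /FC[i ->]; exact: AC|exact: (valY y).1].
have HI : (#|\bigcap_p H p|%SET < k)%N.
  apply: notk' => y /bigcapP yH i; have := yH (i, y) isT; rewrite /H /=.
  case: asboolP => // _; rewrite inE => /asboolP; rewrite subrr => Q0.
  by case: (cone_not0 (tQ (i, y)) Q0).
have [|U [HU Useg Uk Ucrit]] := critical_segments _ ltT Hseg HI.
  by move=> p x; apply/asboolP; rewrite subrr; apply: cone_not0; exact: tQ.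
have Ubig (s : seq 'rV[R]_d) : uniq s -> size s = k ->
    (forall x, x \in s -> exists2 y : YT, (forall p, y \in U p) & val y = x) -> False.
  move=> us ks sU; have := @uniq_fset_leq_card _ YT (\bigcap_p U p)%SET s us.
  rewrite ks leqNgt Uk => /(_ _)/negP[]// x /sU[y yU <-]; exists y => //.
  by apply/bigcapP.
pose J := [set p | U p != [set: YT]%SET]%SET.
have [Jh|Jh] := leqP #|J| h.
  have [G [G0 Gh JG]] : exists G : {set 'I_N},
      [/\ (0 < #|G|)%N, (#|G| <= h)%N & forall p, p \in J -> p.1 \in G].
    have [J0|/set0Pn[p pJ]] := eqVneq J (finset.set0).
      by exists [set i0]%SET; rewrite cards1; split=> // p; rewrite J0 inE.
    exists [set p.1 | p in J]%SET; split.
    - by apply/card_gt0P; exists p.1; apply: imset_f.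
    - exact: leq_trans (leq_imset_card _ _) Jh.
    - by move=> q qJ; apply: imset_f.
  have [|us ks wG] := wP G; first by rewrite G0.
  apply: Ubig us ks _ => x xw; have [Sx CG] := wG x xw.
  have Yx : x \in YT by apply: inY; split=> // j; exact: wM xw.
  exists [` Yx]%fset => // p; have [pJ|] := boolP (p \in J); last first.
    by rewrite inE negbK => /eqP ->; rewrite inE.
  apply: (fintype.subsetP (HU p)); rewrite /H; case: asboolP => [_|nC]; rewrite inE//.
  by apply/asboolP; apply: (QP p).2 nC _ _; exact/CG/JG.
have /boolp.choice[a aP] : forall p : {p | p \in J}, exists a : YT,
    [/\ a \notin U (val p), forall x, lt (val p) x a -> x \in U (val p) &
        forall j, j != val p -> a \in U j].
  by move=> p; apply: Ucrit; have := valP p; rewrite inE.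
have ainj : injective (val \o a).
  move=> p q /val_inj E; apply/val_inj/eqP; apply: contraT => pq.
  by have [] := aP p; rewrite E; have [_ _ ->] := aP q.
have [||p [q [pq [s [us ks sP]]]]] := collide _ _ ainj.
- by move=> i; exact: (valY _).1.
- by rewrite card_sig.
apply: Ubig us ks _ => x /sP[Sx [t /andP[t0 t1] xE]].
have Yx : x \in YT.
  apply: inY; split=> // j; rewrite xE !mxE.
  have := (valY (a p)).2 j; have := (valY (a q)).2 j => /=.
  set u : R := val (a p) _ _; set v : R := val (a q) _ _.
  rewrite !ler_norml => /andP[v1 v2] /andP[u1 u2]; apply/andP; split; nra.
exists [` Yx]%fset => // l.
(* In the order l, the point x precedes the larger of a p and a q, which is in U l
   or is the least point missing from it. *)
have [apq|] : Q l (val (a q) - val (a p)) \/ Q l (- (val (a q) - val (a p))).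
- apply: cone_total => // E; move/eqP: pq; apply.
  by apply: ainj => /=; apply/esym/eqP; rewrite -subr_eq0 E.
- have xq : lt l [` Yx]%fset (a q).
    apply/asboolP => /=; rewrite xE opprD addrA -{1}[val (a q) - _]scale1r -scalerBl.
    by apply: (coneZ (tQ l)) => //; rewrite subr_gt0.
  have [lq|lq] := eqVneq l (val q); first by have [_ + _] := aP q; rewrite -lq; apply.
  by apply: Useg xq _; have [_ _] := aP q; apply.
- rewrite opprB => apq; have xp : lt l [` Yx]%fset (a p).
    apply/asboolP => /=; rewrite xE opprD addrA subrr add0r -scalerN opprB.
    exact: (coneZ (tQ l)).
  have [lp|lp] := eqVneq l (val p); first by have [_ + _] := aP p; rewrite -lp; apply.
  by apply: Useg xp _; have [_ _] := aP p; apply.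
Qed.

(** * Hulls of finite sets *)

Section ConeOrder.
Variables (R : realType) (V : lmodType R) (Q : set V).
Hypothesis tQ : total_cone Q.

Definition cone_ge (x y : V) : Prop := Q (x - y) \/ x = y.

Lemma cone_ge_trans x y z : cone_ge x y -> cone_ge y z -> cone_ge x z.
Proof.
case=> [xy|->//]; case=> [yz|<-]; last by left.
by left; rewrite -(subrK y x) -addrA; exact: (coneD tQ).
Qed.

Lemma cone_geN x y : Q (x - y) -> ~ cone_ge y x.
Proof.
move=> xy [yx|E]; last by rewrite E subrr in xy; exact: (cone_not0 tQ).
by apply: (cone_not0 tQ); have := coneD tQ xy yx; rewrite addrA subrK subrr.
Qed.

Lemma cone_ge_total x y : Q (x - y) \/ cone_ge y x.
Proof.
have [->|/eqP] := eqVneq x y; first by right; right.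
move=> xy; have [//||] := cone_total tQ (x := x - y); last 2 first.
- by left.
- by rewrite opprB; right; left.
by move/subr0_eq.
Qed.

Lemma cone_sum (I : finType) (w : I -> R) (y : I -> V) :
  (forall i, 0 <= w i) -> (forall i, 0 < w i -> Q (y i)) ->
  (exists i, 0 < w i) -> Q (\sum_i w i *: y i).
Proof.
move=> w0 Qy [i0 wi0]; rewrite (bigD1 i0)//=.
have Q0 : Q (w i0 *: y i0) by apply: (coneZ tQ) => //; exact: Qy.
have [->|Qs] : \sum_(i | i != i0) w i *: y i = 0 \/ Q (\sum_(i | i != i0) w i *: y i).
- apply: (big_ind (fun z => z = 0 \/ Q z)); first by left.
    move=> u v [->|Qu]; first by rewrite add0r.
    by case=> [->|Qv]; right; rewrite ?addr0//; exact: (coneD tQ).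
  move=> i _; have := w0 i; rewrite le_eqVlt => /orP[/eqP <-|wi].
    by left; rewrite scale0r.
  by right; apply: (coneZ tQ) => //; exact: Qy.
- by rewrite addr0.
- exact: (coneD tQ).
Qed.

Lemma cone_max (I : finType) (p : I -> V) (i0 : I) :
  exists i, forall j, cone_ge (p i) (p j).
Proof.
pose f i := #|[set j | `[< Q (p i - p j) >]]%SET|.
have [i _ imax] := @arg_maxnP _ i0 predT f isT.
exists i => j; have [ji|//] := cone_ge_total (p j) (p i).
have := imax j isT; rewrite /geq /= leqNgt => /negP[].
apply/proper_card/properP; split.
  apply/fintype.subsetP => l; rewrite 2!finset.inE => /asboolP il; apply/asboolP.
  by rewrite -(subrK (p i) (p j)) -addrA; exact: (coneD tQ).
exists i; rewrite inE; first exact/asboolP.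
by apply/asboolP; rewrite subrr; exact: (cone_not0 tQ).
Qed.

End ConeOrder.

Section FiniteHulls.
Variables (R : realType) (V : lmodType R) (I : finType) (x : I -> V).

Definition hull (A : {set I}) : set V := convex_hull (x @` [set` A]).

Lemma hull_weights (A : {set I}) p : hull A p ->
  exists w : I -> R, [/\ forall i, 0 <= w i, forall i, i \notin A -> w i = 0,
    exists i, 0 < w i & \sum_i w i *: (x i - p) = 0].
Proof.
move=> Ap.
pose C := [set p : V | exists w : I -> R, [/\ forall i, 0 <= w i,
  forall i, i \notin A -> w i = 0, \sum_i w i = 1 & p = \sum_i w i *: x i]].
have [w [w0 wA w1 ->]] : C p.
  apply: Ap; split=> [|_ [i iA <-]].
    apply/convex_setP => t _ _ t0 t1 [u [u0 uA u1 ->]] [v [v0 vA v1 ->]].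
    exists (fun i => t * u i + (1 - t) * v i); split.
    - by move=> i; rewrite addr_ge0 ?mulr_ge0// subr_ge0.
    - by move=> i iA; rewrite uA// vA// !mulr0 addr0.
    - by rewrite big_split /= -!mulr_sumr u1 v1 !mulr1 addrC subrK.
    - rewrite !scaler_sumr -big_split /=; apply: eq_bigr => i _.
      by rewrite [RHS]scalerDl !scalerA.
  exists (fun j => (j == i)%:R); split.
  - by move=> j; exact: ler0n.
  - by move=> j; apply: contraNeq; rewrite pnatr_eq0 eqb0 negbK => /eqP ->.
  - by rewrite (bigD1 i)//= eqxx big1 ?addr0// => j /negbTE ->.
  - rewrite (bigD1 i)//= eqxx scale1r big1 ?addr0// => j /negbTE ->.
    by rewrite scale0r.
exists w; split=> //.
  apply: contrapT => none; move/eqP: w1; rewrite big1 ?(eq_sym 0) ?oner_eq0// => i _.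
  apply/eqP; apply: contraT => wi; case: none; exists i.
  by rewrite lt_neqAle eq_sym wi w0.
under eq_bigr do rewrite scalerBr.
by rewrite sumrB -scaler_suml w1 scale1r subrr.
Qed.

(** Separation replaces the usual induction on the number of points: if p were
    outside the hull, the sum of the w i (p - x i) would be strictly positive in
    the order that separates p from the hull. *)
Lemma weights_hull (A : {set I}) p (w : I -> R) :
  (forall i, 0 <= w i) -> (forall i, i \notin A -> w i = 0) ->
  (exists i, 0 < w i) -> \sum_i w i *: (x i - p) = 0 -> hull A p.
Proof.
move=> w0 wA wpos wp; apply: contrapT => nAp.
have [Q tQ QA] := convex_total_cone (@convex_hull_convex _ _ _) nAp.
apply: (cone_not0 tQ).
have <- : \sum_i w i *: (p - x i) = 0.
  by apply: oppr_inj; rewrite oppr0 -[RHS]wp -sumrN; apply: eq_bigr => i _; rewrite -scalerN opprB.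
apply: (cone_sum tQ) => // i wi; apply: QA => B [_]; apply; exists i => //=.
by apply: contraTT wi => /wA ->; rewrite ltxx.
Qed.

Lemma hull_point (A : {set I}) i : i \in A -> hull A (x i).
Proof. by move=> iA B [_]; apply; exists i. Qed.

Lemma hull_cone_ge (A : {set I}) p (Q : set V) : total_cone Q -> hull A p ->
  exists2 i, i \in A & cone_ge Q (x i) p.
Proof.
move=> tQ /hull_weights[w [w0 wA wpos wp]]; apply: contrapT => none.
apply: (cone_not0 tQ).
have <- : \sum_i w i *: (p - x i) = 0.
  by apply: oppr_inj; rewrite oppr0 -[RHS]wp -sumrN; apply: eq_bigr => i _; rewrite -scalerN opprB.
apply: (cone_sum tQ) => // i wi; have [//|ge] := cone_ge_total tQ p (x i).
case: none; exists i => //.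
by apply: contraTT wi => /wA ->; rewrite ltxx.
Qed.

End FiniteHulls.

Lemma linear_dependence (F : fieldType) (d : nat) (I : finType) (y : I -> 'rV[F]_d)
    (B : {set I}) : (d < #|B|)%N ->
  exists mu : I -> F, [/\ forall i, i \notin B -> mu i = 0, exists i, mu i != 0 &
    \sum_i mu i *: y i = 0].
Proof.
move=> dB; pose M := \matrix_(j < #|B|) y (enum_val j).
have : kermx M != 0.
  by rewrite kermx_eq0 /row_free neq_ltn (leq_ltn_trans (rank_leq_col M) dB).
move=> ker0; pose u := nz_row (kermx M).
have u0 : u != 0 by rewrite nz_row_eq0.
have uM : u *m M = 0 by apply/sub_kermxP; exact: nz_row_sub.
pose mu i := \sum_(j | enum_val j == i) u 0 j.
have muE j : mu (enum_val j) = u 0 j.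
  rewrite /mu (eq_bigl (pred1 j)) ?big_pred1_eq// => j' /=.
  by rewrite (inj_eq enum_val_inj).
exists mu; split=> [i iB||].
- rewrite /mu big_pred0// => j; apply: contraNF iB => /eqP <-; exact: enum_valP.
- have /rV0Pn[j uj] := u0; exists (enum_val j); by rewrite muE.
- rewrite -[RHS]uM mulmx_sum_row /mu.
  under eq_bigr do rewrite scaler_suml.
  rewrite (exchange_big_dep predT)//=; apply: eq_bigr => j _.
  rewrite (big_pred1 (enum_val j)) ?rowK// => i /=; by rewrite eq_sym.
Qed.

(** Suppose that more than d points of T are at or above p. The vectors x i - p for
    these points are dependent; subtracting a suitable multiple of the dependence
    from the weights of p kills the weight of one of them. By minimality of T no
    weight is left, so that the dependence already involved all of T and every
    point of T is at or above p. But p is a combination of them, so they all equal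
    p. *)
Lemma minimal_hull_above (R : realType) (d : nat) (I : finType) (x : I -> 'rV[R]_d)
    (p : 'rV[R]_d) (T : {set I}) (Q : set 'rV[R]_d) :
  (0 < d)%N -> injective x -> total_cone Q ->
  minset (fun A => `[< hull x A p >]) T ->
  (#|[set i in T | `[< cone_ge Q (x i) p >]]%SET| <= d)%N.
Proof.
move=> d0 xinj tQ /minsetP[/asboolP Tp Tmin].
set B := [set i in T | _]%SET; rewrite leqNgt; apply/negP => dB.
have [w [w0 wT [i1 wi1] wp]] := hull_weights Tp.
have BT : B \subset T by apply/fintype.subsetP => i; rewrite inE => /andP[].
have dropT i : i \in T -> ~ hull x (T :\ i)%SET p.
  move=> iT H; have := Tmin (T :\ i)%SET (asboolT H) (subsetDl _ _).
  by move/setP => /(_ i); rewrite !inE eqxx iT.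
have wpos i : i \in T -> 0 < w i.
  move=> iT; rewrite lt_neqAle w0 andbT; apply/negP => /eqP wi.
  apply: (dropT i iT); apply: (@weights_hull _ _ _ _ _ _ w) => //; last by exists i1.
  by move=> j; rewrite !inE negb_and negbK => /orP[/eqP ->//|/wT].
have [mu [muB [i2 mui2] mup] mupos] : exists2 mu : I -> R,
    [/\ forall i, i \notin B -> mu i = 0, exists i, mu i != 0 &
        \sum_i mu i *: (x i - p) = 0] & exists i, 0 < mu i.
  have [mu [muB [i mui] mup]] := linear_dependence (fun i => x i - p) dB.
  have [mi|mi|mi] := ltrgt0P (mu i); last by rewrite mi eqxx in mui.
    by exists mu; [split=> //; exists i|exists i].
  exists (fun i => - mu i); last by exists i; rewrite oppr_gt0.
  split; first by move=> j /muB ->; rewrite oppr0.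
    by exists i; rewrite oppr_eq0.
  by apply: oppr_inj; rewrite oppr0 -[RHS]mup -sumrN; apply: eq_bigr => j _; rewrite scaleNr opprK.
case: mupos => i3 mui3.
have [i0 mui0 imin] := @arg_minP _ _ _ i3 (fun i => 0 < mu i) (fun i => w i / mu i) mui3.
(* The largest s for which all w i - s mu i are nonnegative. *)
pose s := w i0 / mu i0.
have i0B : i0 \in B by apply: contraTT mui0 => /muB ->; rewrite ltxx.
have i0T : i0 \in T by exact: (fintype.subsetP BT).
have s0 : 0 < s by rewrite divr_gt0// wpos.
pose w' i := w i - s * mu i.
have w'0 i : 0 <= w' i.
  rewrite subr_ge0; have [mi|mi] := ltP 0 (mu i).
    by rewrite -ler_pdivlMr//; exact: imin.
  by apply: le_trans (w0 i); rewrite mulr_ge0_le0// ltW.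
have w'T i : i \notin (T :\ i0)%SET -> w' i = 0.
  rewrite !inE negb_and negbK => /orP[/eqP ->|iT].
    by rewrite /w' /s divfK ?subrr// gt_eqF.
  rewrite /w' wT// muB ?mulr0 ?subr0//.
  by apply: contra iT; exact: (fintype.subsetP BT).
have w'p : \sum_i w' i *: (x i - p) = 0.
  rewrite /w'; under eq_bigr do rewrite scalerBl -scalerA.
  by rewrite sumrB wp -scaler_sumr mup scaler0 subrr.
have [w'pos|w'none] := pselect (exists i, 0 < w' i).
  exact: dropT i0T (weights_hull w'0 w'T w'pos w'p).
have TB : T \subset B.
  apply/fintype.subsetP => i iT; apply: contraT => iB; case: w'none; exists i.
  by rewrite /w' muB// mulr0 subr0; exact: wpos.
have ge i : i \in T -> cone_ge Q (x i) p.
  by move=> /(fintype.subsetP TB); rewrite inE => /andP[_ /asboolP].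
have [[i [iT xip]]|none] := pselect (exists i, i \in T /\ x i <> p); last first.
  have xp i : i \in T -> x i = p by move=> iT; apply: contrapT => xip; apply: none; exists i.
  suff : (#|B| <= 1)%N by move: dB d0; lia.
  apply: leq_trans (subset_leq_card BT) _; apply/card_le1P => i iT j.
  rewrite inE; apply/idP/eqP => [jT|->//].
  by apply: xinj; rewrite !xp.
apply: (cone_not0 tQ).
(* The weights of p, without a possible term at p itself. *)
pose v j := if x j == p then 0 else w j.
have <- : \sum_j v j *: (x j - p) = 0.
  rewrite -[RHS]wp; apply: eq_bigr => j _; rewrite /v.
  by case: eqP => // ->; rewrite subrr !scaler0.
apply: (cone_sum tQ).
- by move=> j; rewrite /v; case: ifP.
- move=> j; rewrite /v; case: eqP => [|xj wj]; first by rewrite ltxx.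
  have jT : j \in T by apply: contraTT wj => /wT ->; rewrite ltxx.
  by case: (ge j jT).
- by exists i; rewrite /v; case: eqP => // _; exact: wpos.
Qed.

(** * The Tverberg number *)

Section Greedy.
Variables (R : realType) (d k : nat) (I : finType) (x : I -> 'rV[R]_d).
Variable p : 'I_k -> 'rV[R]_d.
Hypotheses (d0 : (0 < d)%N) (k0 : (0 < k)%N) (xinj : injective x).

Definition above (Q : set 'rV[R]_d) (q : 'rV[R]_d) (A : {set I}) : {set I} :=
  [set i in A | `[< cone_ge Q (x i) q >]]%SET.

(** The union of minimal subsets T l with p l in the hull. The points q above all
    the p l are used because a point above q is then above each p l, so that the
    bounds for the T l add up. *)
Lemma common_hull_subset (A : {set I}) : (forall l, hull x A (p l)) ->
  exists B : {set I}, [/\ B \subset A, forall l, hull x B (p l) &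
    forall Q q, total_cone Q -> (forall l, cone_ge Q q (p l)) ->
      (#|above Q q B| <= k * d)%N].
Proof.
move=> Ap.
have /boolp.choice[T TP] : forall l, exists T : {set I},
    minset (fun A => `[< hull x A (p l) >]) T /\ T \subset A.
  by move=> l; have [T mT TA] :=
    @minset_exists _ (fun A => `[< hull x A (p l) >]) A (asboolT (Ap l)); exists T.
have hullS (B C : {set I}) : B \subset C -> hull x B `<=` hull x C.
  move=> /fintype.subsetP BC y By D [cD CD]; apply: By; split=> // _ [i iB <-].
  by apply: CD; exists i => //; exact: BC.
exists (\bigcup_l T l)%SET; split.
- by apply/bigcupsP => l _; exact: (TP l).2.
- move=> l; apply: (hullS (T l)); first exact: finset.bigcup_sup.
  by apply/asboolP; have [/minsetp] := TP l.
move=> Q q tQ qp.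
have sub : above Q q (\bigcup_l T l)%SET \subset
    (\bigcup_l [set i in T l | `[< cone_ge Q (x i) (p l) >]])%SET.
  apply/fintype.subsetP => i; rewrite inE => /andP[/finset.bigcupP[l _ il] /asboolP iq].
  apply/finset.bigcupP; exists l => //; rewrite inE il; apply/asboolP.
  exact: (cone_ge_trans tQ iq (qp l)).
apply: leq_trans (subset_leq_card sub) _.
apply: leq_trans (_ : \sum_(l < k) d <= _)%N; last by rewrite sum_nat_const card_ord.
elim/big_ind2: _ => [|B b C c Bb Cc|l _]; first by rewrite cards0.
  by apply: leq_trans (leq_card_setU _ _) _; exact: leq_add.
exact: minimal_hull_above (TP l).1.
Qed.

(** An order separating some p l from A would have all of A before the largest
    p l. *)
Lemma above_hull (A : {set I}) :
  (forall Q q, total_cone Q -> (forall l, cone_ge Q q (p l)) ->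
     (exists l, q = p l) -> (0 < #|above Q q A|)%N) ->
  forall l, hull x A (p l).
Proof.
move=> deep l; apply: contrapT => nAp.
have [Q tQ QA] := convex_total_cone (@convex_hull_convex _ _ _) nAp.
have [l0 l0max] := cone_max tQ p l.
have [|i] := card_gt0P (deep Q (p l0) tQ l0max _); first by exists l0.
rewrite inE => /andP[iA /asboolP ge].
apply: (cone_geN tQ (QA (x i) (hull_point iA))).
exact: (cone_ge_trans tQ ge (l0max l)).
Qed.

Lemma greedy_coloring (n : nat) (A : {set I}) :
  (forall Q q, total_cone Q -> (forall l, cone_ge Q q (p l)) ->
     (exists l, q = p l) -> (n * (k * d) < #|above Q q A|)%N) ->
  exists2 c : I -> nat, forall i, (c i <= n)%N &
    forall j, (j <= n)%N -> forall l, hull x [set i in A | c i == j]%SET (p l).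
Proof.
elim: n A => [|n IH] A deep.
  have Ap := above_hull deep.
  exists (fun=> 0%N) => // j; rewrite leqn0 => /eqP -> l.
  by rewrite (_ : [set _ in A | _]%SET = A)//; apply/setP => i; rewrite inE eqxx andbT.
have [B [BA Bp Bsmall]] : exists B : {set I}, [/\ B \subset A, forall l, hull x B (p l) &
    forall Q q, total_cone Q -> (forall l, cone_ge Q q (p l)) ->
      (#|above Q q B| <= k * d)%N].
  apply: common_hull_subset; apply: above_hull => Q q tQ qp ql.
  exact: leq_ltn_trans (leq0n _) (deep Q q tQ qp ql).
have [|c cn cp] := IH (A :\: B)%SET.
  move=> Q q tQ qp ql; have := deep Q q tQ qp ql; have := Bsmall Q q tQ qp.
  have : (#|above Q q A| <= #|above Q q B| + #|above Q q (A :\: B)|)%N.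
    apply: leq_trans (leq_card_setU _ _); apply/subset_leq_card/fintype.subsetP => i.
    by rewrite !inE => /andP[-> ->]; rewrite !andbT orbN.
  by rewrite mulSn; lia.
exists (fun i => if i \in B then n.+1 else c i) => [i|j].
  by case: ifP => // _; apply: leqW.
rewrite leq_eqVlt => /orP[/eqP ->|jn] l.
  rewrite (_ : [set _ in A | _]%SET = B)//; apply/setP => i; rewrite inE.
  case: ifP => [iB|_]; first by rewrite eqxx andbT (fintype.subsetP BA).
  by rewrite [_ == _](_ : _ = false) ?andbF//; have := cn i; lia.
rewrite (_ : [set _ in A | _]%SET = [set i in A :\: B | c i == j]%SET); first exact: cp.
apply/setP => i; rewrite !inE; case: ifP => [iB|_] //=.
by rewrite [_ == _](_ : _ = false) ?andbF//; lia.
Qed.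

End Greedy.

(** The convex sets to which the Helly property is applied are the hulls of the
    subsets of X missing at most (m - 1) k d points; any h of these subsets have k
    points in common by counting. *)
Lemma tverberg_of_helly (R : realType) (d m k h : nat) (S : set 'rV[R]_d) :
  (0 < d)%N -> (0 < m)%N -> (0 < k)%N ->
  helly_prop S k h -> tverberg_prop S m k (h * (m - 1) * k * d + k).
Proof.
move=> d0 m0 k0 helly X XS Xcard.
set N := (_ + k)%N in Xcard; pose D := ((m - 1) * (k * d))%N.
have NE : N = (h * D + k)%N by rewrite /N /D !mulnA.
have [x0 [xX xinj xsurj]] : exists f, set_bij `I_N X f.
  by apply/card_set_bijP; rewrite card_eq_sym.
pose I := 'I_N; pose x (i : I) := x0 i.
have {}xinj : injective x.
  by move=> i j /xinj E; apply/val_inj/E; rewrite inE /=.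
have {}xX i : X (x i) by exact: (xX _ (ltn_ord i)).
have {}xsurj y : X y -> exists i, x i = y.
  by move=> /xsurj[i iN <-]; exists (Ordinal iN).
pose big := [set A : {set I} | (#|~: A| <= D)%N].
have /at_leastP[s [us ks sP]] :
    at_least k ((\bigcap_(C in hull x @` big) C) `&` S).
  apply: helly.
  - by apply: finite_image; exact: finite_finset.
  - by exists (hull x [set: I]%SET), [set: I]%SET => //; rewrite /big /= finset.setCT cards0.
  - by move=> _ [A _ <-]; exact: convex_hull_convex.
  - move=> G GF G0 /pcard_surjP[g gsurj].
    have /boolp.choice[A AP] : forall i : 'I_h, exists A : {set I},
        big A /\ (G (g i) -> g i = hull x A).
      move=> i; have [Ggi|nG] := pselect (G (g i)).
        by have [A bA <-] := GF _ Ggi; exists A.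
      by exists [set: I]%SET; rewrite /big /= finset.setCT cards0.
    pose E := (\bigcap_i A i)%SET.
    have kE : (k <= #|E|)%N.
      have : (#|~: E| <= h * D)%N.
        rewrite /E finset.setC_bigcap.
        apply: leq_trans (_ : \sum_(l < h) D <= _)%N; last by rewrite sum_nat_const card_ord.
        elim/big_ind2: _ => [|B b C c Bb Cc|l _]; first by rewrite cards0.
          by apply: leq_trans (leq_card_setU _ _) _; exact: leq_add.
        exact: (AP l).1.
      have IE : #|{: I}| = (h * D + k)%N by rewrite card_ord NE.
      by move=> EC; rewrite -(leq_add2r #|~: E|) cardsC IE addnC leq_add2r.
    apply/at_leastP; exists (take k [seq x i | i <- enum E]); split.
    + by rewrite take_uniq// map_inj_uniq ?enum_uniq.
    + by rewrite size_takel// size_map -cardE.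
    + move=> y /mem_take/mapP[i]; rewrite mem_enum => /bigcapP iE ->.
      split=> [C GC|]; last exact: XS.
      have [j jh gj] := gsurj C GC.
      have := (AP (Ordinal jh)).2; rewrite /= gj => /(_ GC) ->.
      by apply: hull_point; exact: iE.
pose p (l : 'I_k) := nth 0 s l.
have ps l : p l \in s by rewrite mem_nth// ks.
have [|c cm cp] := @greedy_coloring R d k I x p d0 k0 xinj (m - 1) [set: I]%SET.
  move=> Q q tQ qp [l ql]; rewrite ltnNge; apply/negP => small.
  (* Otherwise the points not above q form one of the subsets in question, and q
     is in its hull. *)
  have [qF _] := sP _ (ps l).
  have /(hull_cone_ge tQ)[i] : hull x (~: above x Q q [set: I])%SET (p l).
    by apply: qF; exists (~: above x Q q [set: I])%SET => //; rewrite /big /= finset.setCK.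
  by rewrite -ql !finset.inE /= => /asboolP.
have jm (j : 'I_m) : (j <= m - 1)%N by have := ltn_ord j; lia.
exists (fun j : 'I_m => x @` [set` [set i | c i == j]%SET]); last first.
  apply/at_leastP; exists s; split=> // y ys; have [_ Sy] := sP y ys; split=> // j _.
  have yk : (index y s < k)%N by rewrite -ks index_mem.
  have := cp j (jm j) (Ordinal yk); rewrite /p /= nth_index// /hull.
  by rewrite (_ : [set i in _ | _]%SET = [set i | c i == j]%SET)//; apply/setP => i; rewrite !inE.
split.
- apply/seteqP; split=> [y [j _ [i _ <-]]|y /xsurj[i <-]]; first exact: xX.
  have cim : (c i < m)%N by have := cm i; lia.
  by exists (Ordinal cim) => //; exists i => //=; rewrite inE.
- move=> i j _ _ [y [[u /= + <-] [v /= + /xinj E]]].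
  by rewrite E !inE => /eqP -> /eqP /val_inj.
- move=> j _; have [w [_ wA [i wi] _]] := hull_weights (cp j (jm j) (Ordinal k0)).
  exists (x i), i => //=; rewrite inE; apply: contraTT wi => cij.
  by rewrite wA ?ltxx// !inE.
Qed.

Lemma least_positive_le (P : nat -> Prop) (N : nat) : (0 < N)%N -> P N ->
  exists2 h, least_positive P = Some h & (h <= N)%N.
Proof.
move=> N0 PN; have exP : exists n, `[< (0 < n)%N /\ P n >].
  by exists N; apply/asboolP.
rewrite /least_positive; case: pselect => // exP'.
exists (ex_minn exP') => //; case: ex_minnP => h _; apply.
exact/asboolP.
Qed.

Lemma helly_lattice_difference (R : realType) (d m k : nat) (L : set 'rV[R]_d)
    (Ls : 'I_m -> set 'rV[R]_d) :
  is_lattice L -> (forall i, is_sublattice (Ls i) L) ->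
  helly_prop (L `\` \bigcup_i Ls i) k ((2 ^ m.+1 * k + 1) ^ lattice_rank L).
Proof.
move=> latL subL; have sL := latL.1.
apply: helly_of_collisions => [|M|I a ainj Sa cardI].
- by rewrite expn_gt0 addn1.
- by apply: sub_finite_set (lattice_bounded_finite latL M) => x [[Lx _] xM].
have [||i [j [ij [v Lv aj]]]] := @lattice_pigeonhole R d L latL _ I a _ _ cardI.
- by rewrite addn1.
- by move=> i; case: (Sa i).
exists i, j; split=> //; rewrite aj.
apply: (progression_points (L := L) (v := v)) => //.
- by move=> l; exact: (subL l).1.
- by rewrite addn1 ltnS leq_mul2r leq_exp2l// leqnSn orbT.
- by apply: contra_neq ij => v0; apply: ainj; rewrite aj v0 mul0rn addr0.
- by rewrite -aj.
Qed.

Theorem theorem1p6 (R : realType) (d m k : nat)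
    (hd : (1 <= d)%N) (hm : (1 <= m)%N) (hk : (1 <= k)%N)
    (L : set 'rV[R]_d) (Ls : 'I_m -> set 'rV[R]_d)
    (hL : is_lattice L) (hLs : forall i, is_sublattice (Ls i) L)
    (S : set 'rV[R]_d) (hS : S = L `\` \bigcup_i Ls i)
    (r : nat) (hr : r = lattice_rank L) :
  (exists2 h : nat, helly_number S k = Some h &
     (h <= (2 ^ m.+1 * k + 1) ^ r)%N) /\
  (exists2 N : nat, tverberg_number S m k = Some N &
     (N <= (2 ^ m.+1 * k + 1) ^ r * (m - 1) * k * d + k)%N).
Proof.
have HS : helly_prop S k ((2 ^ m.+1 * k + 1) ^ r).
  by rewrite hS hr; exact: helly_lattice_difference.
split; apply: least_positive_le => //.
- by rewrite expn_gt0 addn1.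
- by rewrite addn_gt0 hk orbT.
- exact: tverberg_of_helly.
Qed.
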